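(* Let $M$ be a $\sigma$-effect monoid. Then the opposite category $\boldsymbol{\sigma}\mathbf{EMod}_M^{\mathrm{op}}$ of the category of $\sigma$-effect $M$-modules is a $\sigma$-effectus, with unit object $M$.
   Context: Countable means finite (possibly empty) or countably infinite. A partial commutative monoid (PCM) is a set $X$ with $0\in X$ and a partial binary operation $\oplus$ with $(x\oplus y)\oplus z=x\oplus(y\oplus z)$, $x\oplus y=y\oplus x$, $0\oplus x=x$, where ''$=$'' is Kleene equality (if either side is defined, so is the other, and they are equal); $x\perp y$ means $x\oplus y$ is defined. An effect algebra is a PCM $E$ with an element $1\in E$ such that for each $a\in E$ there is a unique $a^{\perp}\in E$ with $a\oplus a^{\perp}=1$, and $a\perp 1$ implies $a=0$; it is partially ordered by $a\le b$ iff $a\oplus c=b$ for some $c$. A $\sigma$-PAM is a nonempty set $M$ with a partial operation $\bigoplus$ sending countable families $(x_j)_{j\in J}$ in $M$ to elements of $M$ (a family is summable if its sum is defined), such that: (partition-associativity) for each countable family $(x_j)_{j\in J}$ and countable partition $J=\biguplus_{k\in K}J_k$, the family is summable iff each $(x_j)_{j\in J_k}$ is summable and $(\bigoplus_{j\in J_k}x_j)_{k\in K}$ is summable, and then $\bigoplus_{j\in J}x_j=\bigoplus_{k\in K}\bigoplus_{j\in J_k}x_j$; (unary sum) one-element families are summable with sum their element; (limit) a countable family is summable whenever all its finite subfamilies are. A $\sigma$-PAM is a PCM with $x_1\oplus x_2=\bigoplus_{i\in\{1,2\}}x_i$ and $0=\bigoplus\emptyset$. A map between $\sigma$-PAMs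 is $\sigma$-additive if it sends summable families to summable families and preserves their sums; $\sigma$-biadditive means $\sigma$-additive in each argument. A $\sigma$-PAC is a category $\mathbf{C}$ with countable coproducts (coprojections $\kappa_i$), all of whose homsets are $\sigma$-PAMs with $\sigma$-biadditive composition (so there are zero morphisms $0_{AB}$), such that: (compatible sum) every compatible countable family $(f_j\colon A\to B)_{j\in J}$ is summable in $\mathbf{C}(A,B)$; (untying) if $f,g\colon A\to B$ are summable then so are $\kappa_1\circ f,\kappa_2\circ g\colon A\to B+B$. Here $(f_j\colon A\to B_j)_{j\in J}$ is compatible if there is $f\colon A\to\coprod_{j}B_j$ with $\triangleright_j\circ f=f_j$ for all $j$, where the partial projection $\triangleright_i\colon\coprod_jB_j\to B_i$ is determined by $\triangleright_i\circ\kappa_i=\mathrm{id}$ and $\triangleright_i\circ\kappa_k=0$ for $k\ne i$. A $\sigma$-effectus is a $\sigma$-PAC $\mathbf{C}$ with a distinguished ''unit'' object $I$ such that: (i) for each $A$, the PCM $\mathbf{C}(A,I)$ is an effect algebra, with top written $\mathbf{1}_A$; (ii) $\mathbf{1}_B\circ f=0_{AI}$ implies $f=0_{AB}$ for all $f\colon A\to B$; (iii) $\mathbf{1}_B\circ f\perp\mathbf{1}_B\circ g$ implies $f\perp g$ for all $f,g\colon A\to B$. Asserting that a category is a $\sigma$-effectus includes the existence of a suitable $\sigma$-PAM structure on each homset. A $\sigma$-effect algebra is an effect algebra in which every increasing sequence has a supremum; it is a $\sigma$-PAM where a countable family is summable iff all its finite subfamilies are, and then $\bigoplus_{j\in J}x_j=\bigvee_{F\subseteq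 J\text{ finite}}\bigoplus_{j\in F}x_j$. A $\sigma$-effect monoid is a $\sigma$-effect algebra $M$ with an associative total $\sigma$-biadditive operation $\cdot\colon M\times M\to M$ with $a\cdot1=a=1\cdot a$. A $\sigma$-effect $M$-module is a $\sigma$-effect algebra $E$ with a $\sigma$-biadditive map $\cdot\colon M\times E\to E$ satisfying $1\cdot x=x$ and $(r\cdot s)\cdot x=r\cdot(s\cdot x)$. $\boldsymbol{\sigma}\mathbf{EMod}_M$ is the category of $\sigma$-effect $M$-modules and $\sigma$-additive maps $f$ with $f(r\cdot x)=r\cdot f(x)$ (preservation of $1$ is not required). *)

(* Defs.v *)
From mathcomp Require Import all_boot finmap.
From mathcomp Require Import boolp classical_sets.

Set Implicit Arguments.
Unset Strict Implicit.
Unset Printing Implicit Defensive.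

Local Open Scope classical_set_scope.

(** ** Partial commutative monoids and effect algebras *)

(* Partial operations are [option]-valued, so Kleene equality is equality of
   options. *)
Record pcm := PCM {
  pcm_sort :> Type;
  pzero : pcm_sort;
  padd : pcm_sort -> pcm_sort -> option pcm_sort;
  paddA : forall x y z,
    obind (fun s => padd s z) (padd x y) = obind (padd x) (padd y z);
  paddC : forall x y, padd x y = padd y x;
  padd0 : forall x, padd pzero x = Some x
}.
Arguments pzero {_}.
Arguments padd {_}.

Definition orthogonal (X : pcm) (x y : X) : bool := isSome (padd x y).

Definition pcm_seqsum (X : pcm) (s : seq X) : option X :=
  foldr (fun x acc => obind (padd x) acc) (Some pzero) s.

Definition is_effect_algebra (E : pcm) (one : E) : Prop :=
  (forall a : E, exists! a' : E, padd a a' = Some one) /\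
  (forall a : E, orthogonal a one -> a = pzero).

Record effect_algebra := EffectAlgebra {
  ea_pcm :> pcm;
  ea_one : ea_pcm;
  ea_axioms : is_effect_algebra ea_one
}.
Arguments ea_one {_}.

Definition ea_le (E : effect_algebra) (a b : E) : Prop :=
  exists c, padd a c = Some b.

Definition is_supremum (E : effect_algebra) (A : set E) (s : E) : Prop :=
  (forall a, A a -> ea_le a s) /\
  (forall b, (forall a, A a -> ea_le a b) -> ea_le s b).

(** ** Partial sums of countable families *)

(* Countable index sets are the types with a [countType] structure (finite and
   empty ones included). *)
Definition countable_sum (X : Type) := forall J : countType, (J -> X) -> option X.

Definition sigma_additive (X Y : Type) (sX : countable_sum X)
    (sY : countable_sum Y) (f : X -> Y) : Prop :=
  forall (J : countType) (x : J -> X) (s : X),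
    sX J x = Some s -> sY J (f \o x) = Some (f s).

Definition sigma_biadditive (X Y Z : Type) (sX : countable_sum X)
    (sY : countable_sum Y) (sZ : countable_sum Z) (f : X -> Y -> Z) : Prop :=
  (forall x, sigma_additive sY sZ (f x)) /\
  (forall y, sigma_additive sX sZ (f ^~ y)).

Definition fiber (J K : countType) (p : J -> K) (k : K) : countType :=
  {j : J | p j == k}.

(* A partition of [J] into blocks indexed by [K], possibly empty, is given by the
   map sending each index to the block containing it. *)
Record sigma_pam (X : Type) := SigmaPAM {
  psum : countable_sum X;
  pam_inhabited : inhabited X;
  psum_partition : forall (J K : countType) (p : J -> K) (x : J -> X) (s : X),
    psum x = Some s <->
    exists y : K -> X,
      (forall k, psum (fun j : fiber p k => x (val j)) = Some (y k)) /\
      psum y = Some s;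
  psum_unary : forall (J : countType) (j0 : J) (x : J -> X),
    (forall j, j = j0) -> psum x = Some (x j0);
  psum_limit : forall (J : countType) (x : J -> X),
    (forall F : {fset J}, isSome (psum (fun j : F => x (val j)))) ->
    isSome (psum x)
}.

Definition pam_pair (X : Type) (x y : X) (b : bool) : X := if b then x else y.

Section SigmaPAMasPCM.
Variables (X : Type) (S : sigma_pam X).

Let option_ext (u v : option X) :
  (forall s, u = Some s <-> v = Some s) -> u = v.
Proof.
case: u v => [a|] [b|] uv //; first by apply/esym; apply/(uv a).
  by move: (proj1 (uv a) erefl).
by move: (proj2 (uv b) erefl).
Qed.

Lemma psum_reindex (J K : countType) (h : J -> K) (y : K -> X) :
  bijective h -> psum S (y \o h) = psum S y.
Proof.
move=> [g hK gK].
have fib k : psum S (fun j : fiber h k => (y \o h) (val j)) = Some (y k).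
  have hg : h (g k) == k by rewrite gK.
  rewrite (psum_unary S (j0 := exist _ (g k) hg : fiber h k)) /= ?gK//.
  by move=> [j /= hj]; apply: val_inj => /=; rewrite -(eqP hj) hK.
apply: option_ext => s; split.
- move/(psum_partition S h) => [y' [Hy' <-]].
  by congr (psum S _); apply/funext => k; move: (Hy' k); rewrite fib => -[].
- by move=> Hs; apply/(psum_partition S h); exists y.
Qed.

Lemma psum_void : {z : X | forall f : void -> X, psum S f = Some z}.
Proof.
case e: (psum S (of_void X)) => [z|].
  by exists z => f; rewrite -e; congr (psum S _); apply/funext => -[].
exfalso; case: (pam_inhabited S) => x.
have := psum_unary S (j0 := tt) (fun=> x) (fun 'tt => erefl).
move/(psum_partition S (fun=> true)) => [y [/(_ false) + _]].
pose h (j : void) : fiber (fun _ : unit => true) false := match j with end.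
have bh : bijective h by exists (fun j => False_rect _ (notF (valP j))) => -[].
rewrite -(psum_reindex _ bh); set f := _ \o _.
by have -> : f = of_void X by [apply/funext => -[]]; rewrite e.
Qed.

Definition pam_zero : X := sval psum_void.

Definition pam_add (x y : X) : option X := psum S (pam_pair x y).

Lemma psum_sum (J K : countType) (x : J + K -> X) :
  psum S x = obind (fun a => obind (pam_add a) (psum S (x \o inr)))
                   (psum S (x \o inl)).
Proof.
pose p (u : J + K) := if u is inl _ then true else false.
pose hl (j : J) : fiber p true := exist _ (inl j) erefl.
pose hr (k : K) : fiber p false := exist _ (inr k) erefl.
have bl : bijective hl.
  exists (fun u => match u with
    exist (inl j) _ => j | exist (inr k) e => False_rect _ (notF e) end) => //.
  by move=> [[j|k] e] //; apply: val_inj.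
have br : bijective hr.
  exists (fun u => match u with
    exist (inr k) _ => k | exist (inl j) e => False_rect _ (notF e) end) => //.
  by move=> [[j|k] e] //; apply: val_inj.
have fl := psum_reindex (fun j : fiber p true => x (val j)) bl.
have fr := psum_reindex (fun j : fiber p false => x (val j)) br.
apply: option_ext => s; split.
- move/(psum_partition S p) => [y [Hy <-]].
  rewrite -[x \o inl]/((fun j : fiber p true => x (val j)) \o hl) fl Hy /=.
  rewrite -[x \o inr]/((fun j : fiber p false => x (val j)) \o hr) fr Hy /=.
  by congr (psum S _); apply/funext => -[].
- rewrite -[x \o inl]/((fun j : fiber p true => x (val j)) \o hl) fl.
  rewrite -[x \o inr]/((fun j : fiber p false => x (val j)) \o hr) fr.
  case el: (psum S (fun j : fiber p true => _)) => [a|] //=.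
  case er: (psum S (fun j : fiber p false => _)) => [b|] //= ab.
  by apply/(psum_partition S p); exists (pam_pair a b); split => // -[].
Qed.

Let psum_unit (f : unit -> X) : psum S f = Some (f tt).
Proof. by apply: psum_unary => -[]. Qed.

Lemma pam_addC x y : pam_add x y = pam_add y x.
Proof.
rewrite /pam_add -(psum_reindex (h := negb)); last by exists negb => -[].
by congr (psum S _); apply/funext => -[].
Qed.

Lemma pam_add0 x : pam_add pam_zero x = Some x.
Proof.
pose f (u : void + unit) := x.
have := psum_sum f; rewrite (svalP psum_void) psum_unit /= => <-.
by apply: (psum_unary S (j0 := inr tt)) => -[[]|[]].
Qed.

Lemma pam_addA x y z :
  obind (fun s => pam_add s z) (pam_add x y) = obind (pam_add x) (pam_add y z).
Proof.
pose f (u : (unit + unit) + unit) :=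
  match u with inl (inl _) => x | inl (inr _) => y | inr _ => z end.
pose h (u : unit + (unit + unit)) : (unit + unit) + unit :=
  match u with inl u => inl (inl u) | inr (inl u) => inl (inr u)
             | inr (inr u) => inr u end.
have bh : bijective h.
  exists (fun u => match u with inl (inl u) => inl u | inl (inr u) => inr (inl u)
                              | inr u => inr (inr u) end) => [[|[]]|[[]|]] //.
have /esym := psum_reindex f bh.
by rewrite !psum_sum !psum_unit /=; case: (pam_add x y).
Qed.

Definition pam_pcm : pcm := PCM pam_addA pam_addC pam_add0.

End SigmaPAMasPCM.

(** ** Sigma-effect algebras, monoids and modules *)

Record sigma_effect_algebra := SigmaEffectAlgebra {
  sea_ea :> effect_algebra;
  sea_sup : forall a : nat -> sea_ea, (forall n, ea_le (a n) (a n.+1)) ->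
    exists s, is_supremum (range a) s
}.

Section SigmaEffectAlgebraSum.
Variables (E : sigma_effect_algebra) (J : countType) (x : J -> E).

Definition sea_finsum (F : {fset J}) : option E :=
  pcm_seqsum [seq x j | j <- F].

Definition sea_finsums : set E := [set s | exists F, sea_finsum F = Some s].

(* When all finite subfamilies are summable, the supremum always exists (as that
   of an increasing sequence of finite sums); the default [pzero] is never
   used. *)
Definition sea_sum : option E :=
  if `[< forall F, isSome (sea_finsum F) >] then
    Some (if pselect (exists s, is_supremum sea_finsums s) is left sup_ex
          then sval (cid sup_ex) else pzero)
  else None.

End SigmaEffectAlgebraSum.
Arguments sea_sum : clear implicits.

Record sigma_effect_monoid := SigmaEffectMonoid {
  sem_sea :> sigma_effect_algebra;
  sem_mul : sem_sea -> sem_sea -> sem_sea;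
  sem_mul_biadditive :
    sigma_biadditive (sea_sum sem_sea) (sea_sum sem_sea) (sea_sum sem_sea)
      sem_mul;
  sem_mulA : forall a b c, sem_mul a (sem_mul b c) = sem_mul (sem_mul a b) c;
  sem_mul1 : forall a, sem_mul a ea_one = a;
  sem_1mul : forall a, sem_mul ea_one a = a
}.
Arguments sem_mul {_}.

Record sigma_effect_module (M : sigma_effect_monoid) := SigmaEffectModule {
  smod_sea :> sigma_effect_algebra;
  smod_act : M -> smod_sea -> smod_sea;
  smod_act_biadditive :
    sigma_biadditive (sea_sum M) (sea_sum smod_sea) (sea_sum smod_sea) smod_act;
  smod_act1 : forall x, smod_act ea_one x = x;
  smod_actA : forall r s x, smod_act (sem_mul r s) x = smod_act r (smod_act s x)
}.
Arguments smod_act {_ _}.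

Definition regular_module (M : sigma_effect_monoid) : sigma_effect_module M :=
  @SigmaEffectModule M M sem_mul (@sem_mul_biadditive M) (@sem_1mul M)
    (fun r s x => esym (sem_mulA r s x)).

Record smod_hom (M : sigma_effect_monoid) (E F : sigma_effect_module M) :=
  SmodHom {
    smod_map :> E -> F;
    smod_map_additive : sigma_additive (sea_sum E) (sea_sum F) smod_map;
    smod_map_linear : forall r x, smod_map (smod_act r x) = smod_act r (smod_map x)
  }.

Lemma smod_hom_ext (M : sigma_effect_monoid) (E F : sigma_effect_module M)
  (f g : smod_hom E F) : f =1 g -> f = g.
Proof.
case: f g => [f f1 f2] [g g1 g2] /= /funext fg; subst g.
by congr SmodHom; apply: Prop_irrelevance.
Qed.

(** ** Categories *)

Record category := Category {
  obj :> Type;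
  hom : obj -> obj -> Type;
  idm : forall A, hom A A;
  compm : forall A B C, hom B C -> hom A B -> hom A C;
  compmA : forall A B C D (h : hom C D) (g : hom B C) (f : hom A B),
    compm h (compm g f) = compm (compm h g) f;
  comp1m : forall A B (f : hom A B), compm (idm B) f = f;
  compm1 : forall A B (f : hom A B), compm f (idm A) = f
}.
Arguments idm {_}.
Arguments compm {_ _ _ _}.

Definition opposite (C : category) : category :=
  @Category C (fun A B => hom B A) (@idm C) (fun A B D g f => compm f g)
    (fun A B D E h g f => esym (compmA f g h))
    (fun A B f => compm1 f) (fun A B f => comp1m f).

Section SigmaEMod.
Variable M : sigma_effect_monoid.

Definition smod_id (E : sigma_effect_module M) : smod_hom E E :=
  @SmodHom M E E id (fun J x s Hs => Hs) (fun r x => erefl).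

Definition smod_comp (E F G : sigma_effect_module M)
    (g : smod_hom F G) (f : smod_hom E F) : smod_hom E G :=
  @SmodHom M E G (g \o f)
    (fun J x s Hs => smod_map_additive g (smod_map_additive f Hs))
    (fun r x => etrans (congr1 g (smod_map_linear f r x))
                       (smod_map_linear g r (f x))).

Lemma smod_compA (E F G H : sigma_effect_module M)
    (h : smod_hom G H) (g : smod_hom F G) (f : smod_hom E F) :
  smod_comp h (smod_comp g f) = smod_comp (smod_comp h g) f.
Proof. exact: smod_hom_ext. Qed.

Lemma smod_comp1m (E F : sigma_effect_module M) (f : smod_hom E F) :
  smod_comp (smod_id F) f = f.
Proof. exact: smod_hom_ext. Qed.

Lemma smod_compm1 (E F : sigma_effect_module M) (f : smod_hom E F) :
  smod_comp f (smod_id E) = f.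
Proof. exact: smod_hom_ext. Qed.

Definition sigmaEMod : category := Category smod_compA smod_comp1m smod_compm1.

End SigmaEMod.

Record coproduct (C : category) (J : countType) (B : J -> C) := Coproduct {
  coprod :> C;
  coproj : forall j, hom (B j) coprod;
  cotuple : forall X : C, (forall j, hom (B j) X) -> hom coprod X;
  cotupleE : forall X (f : forall j, hom (B j) X) j,
    compm (cotuple f) (coproj j) = f j;
  cotuple_unique : forall X (f : forall j, hom (B j) X) (h : hom coprod X),
    (forall j, compm h (coproj j) = f j) -> h = cotuple f
}.

(** ** Sigma-PACs and sigma-effectuses *)

Definition zero_morphism (C : category) (P : forall A B : C, sigma_pam (hom A B))
  (A B : C) : hom A B := pam_zero (P A B).

Section PartialProjections.
Variables (C : category) (P : forall A B : C, sigma_pam (hom A B)).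
Variables (J : countType) (B : J -> C) (S : coproduct B).

Definition partial_projection (i : J) : hom S (B i) :=
  cotuple S (fun k =>
    if k =P i is ReflectT e then ecast l (hom (B k) (B l)) e (idm (B k))
    else zero_morphism P (B k) (B i)).

Lemma partial_projection_eq i :
  compm (partial_projection i) (coproj S i) = idm (B i).
Proof.
rewrite cotupleE; case: (i =P i) => // e.
by rewrite (eq_irrelevance e erefl).
Qed.

Lemma partial_projection_neq i k : k != i ->
  compm (partial_projection i) (coproj S k) = zero_morphism P (B k) (B i).
Proof. by rewrite cotupleE; case: (k =P i). Qed.

Definition compatible (A : C) (f : forall j, hom A (B j)) : Prop :=
  exists g : hom A S, forall j, compm (partial_projection j) g = f j.

End PartialProjections.

(* Binary sums and coproducts are indexed by [bool], with [true] for the first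
   component. *)
Record sigma_pac_structure (C : category) := SigmaPACStructure {
  pac_coproduct : forall (J : countType) (B : J -> C), coproduct B;
  pac_hom : forall A B : C, sigma_pam (hom A B);
  pac_comp_biadditive : forall A B D : C,
    sigma_biadditive (psum (pac_hom B D)) (psum (pac_hom A B))
      (psum (pac_hom A D)) compm;
  pac_compatible_sum : forall (A B : C) (J : countType) (f : J -> hom A B),
    compatible pac_hom (pac_coproduct (fun _ : J => B)) f ->
    isSome (psum (pac_hom A B) f);
  pac_untying : forall (A B : C) (f g : hom A B),
    let BB := pac_coproduct (fun _ : bool => B) in
    orthogonal (X := pam_pcm (pac_hom A B)) f g ->
    orthogonal (X := pam_pcm (pac_hom A BB))
      (compm (coproj BB true) f) (compm (coproj BB false) g)
}.

Definition is_sigma_effectus (C : category) (I : C) : Prop :=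
  exists (S : sigma_pac_structure C) (one : forall A : C, hom A I),
    let homPCM (A B : C) : pcm := pam_pcm (pac_hom S A B) in
    [/\ forall A : C, is_effect_algebra (E := homPCM A I) (one A),
        forall (A B : C) (f : hom A B),
          compm (one B) f = zero_morphism (pac_hom S) A I ->
          f = zero_morphism (pac_hom S) A B
      & forall (A B : C) (f g : hom A B),
          orthogonal (X := homPCM A I) (compm (one B) f) (compm (one B) g) ->
          orthogonal (X := homPCM A B) f g].

(* Main.v *)
Require Import Defs.
From HB Require Import structures.
From mathcomp Require Import all_boot finmap.
From mathcomp Require Import boolp classical_sets.

Set Implicit Arguments.
Unset Strict Implicit.
Unset Printing Implicit Defensive.

(* Sums in the dual of the module category are computed pointwise, so everything
   rests on the countable sums of a sigma-effect algebra E.  Since addition is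
   cancellative and E has complements, addition commutes with suprema, which
   makes the countable sums of E partition-associative.  Products of modules,
   the coproducts of the dual, are componentwise; a compatible family of maps is
   then summable because x is the sum of its components in a power of B, and a
   map f is controlled by f 1: it determines f when the domain is M, and
   orthogonality of f and g amounts to that of f 1 and g 1. *)

Lemma option_ext (T : Type) (u v : option T) :
  (forall s, u = Some s <-> v = Some s) -> u = v.
Proof.
case: u v => [a|] [b|] uv //; first by apply/esym; apply/(uv a).
  by move: (proj1 (uv a) erefl).
by move: (proj2 (uv b) erefl).
Qed.

(** * Finite sums in a partial commutative monoid *)

Section OptionSum.
Variable X : pcm.
Implicit Types u v w : option X.

(** With [None] absorbing, the partial addition becomes a total commutative monoid law, so finite
    sums are iterated operations and Kleene equalities are plain equations. *)
Definition oadd u v : option X := obind (fun a => obind (padd a) v) u.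

Lemma oaddA : associative oadd.
Proof.
move=> [a|] [b|] [c|] //=; last by case: (padd a b).
by rewrite -(paddA a b c); case: (padd a b).
Qed.

Lemma oaddC : commutative oadd.
Proof. by move=> [a|] [b|] //=; rewrite paddC. Qed.

Lemma oadd0 : left_id (Some pzero) oadd.
Proof. by move=> [a|] //=; rewrite padd0. Qed.

HB.instance Definition _ := Monoid.isComLaw.Build (option X) (Some pzero) oadd
  oaddA oaddC oadd0.

Definition osum (J : Type) (x : J -> X) (l : seq J) : option X :=
  \big[oadd/Some pzero]_(j <- l) Some (x j).

Lemma pcm_seqsum_osum (J : Type) (x : J -> X) l :
  pcm_seqsum (map x l) = osum x l.
Proof.
by rewrite /osum; elim: l => [|j l IH] /=; rewrite ?big_nil// big_cons -IH.
Qed.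

Lemma osum_map (J K : Type) (h : K -> J) (x : J -> X) l :
  osum x (map h l) = osum (x \o h) l.
Proof. by rewrite /osum big_map. Qed.

Lemma osum_nil (J : Type) (x : J -> X) : osum x [::] = Some pzero.
Proof. by rewrite /osum big_nil. Qed.

Lemma osum_cons (J : Type) (x : J -> X) j l :
  osum x (j :: l) = oadd (Some (x j)) (osum x l).
Proof. by rewrite /osum big_cons. Qed.

Lemma osum_cat (J : Type) (x : J -> X) l l' :
  osum x (l ++ l') = oadd (osum x l) (osum x l').
Proof. by rewrite /osum big_cat. Qed.

Lemma osum_perm (J : eqType) (x : J -> X) l l' :
  perm_eq l l' -> osum x l = osum x l'.
Proof. by move=> ll'; rewrite /osum (perm_big _ ll'). Qed.

Lemma osum_sub (J : eqType) (x : J -> X) (l l' : seq J) :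
  uniq l -> uniq l' -> {subset l <= l'} ->
  osum x l' = oadd (osum x l) (osum x [seq j <- l' | j \notin l]).
Proof.
move=> ul ul' sub; rewrite -osum_cat; apply: osum_perm; apply: uniq_perm => //.
  rewrite cat_uniq ul filter_uniq// andbT /=.
  by apply/hasPn => j; rewrite mem_filter => /andP[].
move=> j; rewrite mem_cat mem_filter.
by case: (boolP (j \in l)) => //= /sub ->.
Qed.

End OptionSum.

(** * Cancellation, order and suprema in an effect algebra *)

Section EffectAlgebra.
Variable E : effect_algebra.
Implicit Types (a b c s : E) (u v w : option E).

Lemma padd_some_l a u s : oadd (Some a) u = Some s ->
  exists2 b, u = Some b & padd a b = Some s.
Proof. by case: u => //= b; exists b. Qed.

Lemma compl_exists a : exists a', padd a a' = Some ea_one.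
Proof. by have [/(_ a)[a' [? _]] _] := ea_axioms E; exists a'. Qed.

(** With [s'] the complement of [s], both [b] and [c] complement the sum of [a] and [s'], and
    complements are unique. *)
Lemma padd_cancel a b c s : padd a b = Some s -> padd a c = Some s -> b = c.
Proof.
move=> ab ac; have [s' ss'] := compl_exists s.
have comp z : padd a z = Some s ->
    oadd (oadd (Some a) (Some s')) (Some z) = Some ea_one.
  by move=> az; rewrite -oaddA (oaddC (Some s')) oaddA /= az.
have := comp _ ab; have := comp _ ac.
case: (oadd (Some a) (Some s')) => //= u uc ub.
have [/(_ u)[z [_ uniqz]] _] := ea_axioms E.
by rewrite -(uniqz _ ub) -(uniqz _ uc).
Qed.

(** Since [a] and [b] add up to zero, the triple sum of [b], [a] and [ea_one] is defined; by
    associativity [a] is orthogonal to [ea_one]. *)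
Lemma padd_eq0 a b : padd a b = Some pzero -> a = pzero.
Proof.
move=> ab; have [_ /(_ a)] := ea_axioms E; apply.
have : oadd (oadd (Some b) (Some a)) (Some ea_one) = Some ea_one.
  by rewrite (oaddC (Some b)) [oadd (Some a) _]ab oadd0.
by rewrite -oaddA /orthogonal /=; case: padd.
Qed.

(* [u] is defined and below [b]. *)
Definition ole u b : Prop := exists d, oadd u (Some d) = Some b.

Lemma ole_addl u v b : ole (oadd u v) b -> ole u b.
Proof.
by move=> [d]; rewrite -oaddA; case: (oadd v _) => [e|]; [exists e|case: u].
Qed.

Lemma ole_one a : ole (Some a) ea_one.
Proof. by have [a' aa'] := compl_exists a; exists a'. Qed.

Lemma ole_isSome u b : ole u b -> isSome u.
Proof. by case: u => // -[]. Qed.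

Lemma ea_le_refl a : ea_le a a.
Proof. by exists pzero; rewrite paddC padd0. Qed.

Lemma ea_le_anti a b : ea_le a b -> ea_le b a -> a = b.
Proof.
move=> [c ac] [d bd]; have [] := ac.
have : oadd (Some a) (oadd (Some c) (Some d)) = Some a.
  by rewrite oaddA /= ac.
move/padd_some_l => [e cd ae].
have e0 : e = pzero.
  by apply: (padd_cancel ae); rewrite paddC padd0.
rewrite e0 in cd; rewrite (padd_eq0 cd) paddC padd0 => -[//].
Qed.

(* Addition is continuous for arbitrary nonempty suprema: an upper bound [b] of
   the [c + a] is [c + e] for some [e], and cancelling [c] makes [e] an upper
   bound of [A]. *)
Lemma ole_add_sup (A : set E) s a0 : is_supremum A s -> A a0 ->
  forall w b, ole (oadd w (Some s)) b <-> forall a, A a -> ole (oadd w (Some a)) b.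
Proof.
move=> [sA sm] Aa0 w b; split=> [wsb a /sA [d ad]|H].
  by apply: (@ole_addl _ (Some d)); rewrite -oaddA /= ad.
have [e we] := ole_addl (H _ Aa0); case: w H we => // c H ce.
have [|f sf] := sm e.
  move=> a /H [d]; rewrite -oaddA => /padd_some_l [f adf cf].
  by exists d; rewrite -(padd_cancel cf ce).
by exists f; rewrite -oaddA /= sf.
Qed.

End EffectAlgebra.

(** * Countable sums in a sigma-effect algebra *)

Section SigmaSum.
Variable E : sigma_effect_algebra.
Implicit Types (J K : countType).

(** Duplicate-free lists are easier to split and permute than finite sets. The arbitrary [P] serves
    both definedness and upper bounds. *)
Lemma sea_finsumsP J (x : J -> E) (P : option E -> Prop) :
  (forall F, P (sea_finsum x F)) <-> (forall l, uniq l -> P (osum x l)).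
Proof.
split=> [H l ul|H F]; last first.
  by rewrite /sea_finsum pcm_seqsum_osum; apply: H; apply: fset_uniq.
have := H [fset j in l]%fset; rewrite /sea_finsum pcm_seqsum_osum.
rewrite (@osum_perm _ _ _ _ l)//; apply: uniq_perm => // [|j].
  exact: fset_uniq.
by rewrite inE.
Qed.

Lemma sea_summableP J (x : J -> E) :
  isSome (sea_sum E J x) <-> forall l, uniq l -> isSome (osum x l).
Proof.
rewrite -(sea_finsumsP x (fun u => isSome u)) /sea_sum.
by case: asboolP.
Qed.

(** Suprema are granted for increasing sequences only. The sums over initial segments of an
    enumeration of [J] increase and dominate every finite sum, so their supremum is that of all
    finite sums. *)
Lemma finsums_sup J (x : J -> E) :
  (forall l, uniq l -> isSome (osum x l)) ->
  exists s, is_supremum (sea_finsums x) s.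
Proof.
move=> H.
pose pre n : seq J := pmap pickle_inv (iota 0 n).
have pre_uniq n : uniq (pre n).
  by apply: (pmap_uniq (@pickle_invK J)); apply: iota_uniq.
have pre_mem n j : (j \in pre n) = (choice.pickle j < n).
  rewrite mem_pmap; apply/mapP/idP => [[i]|jn].
    rewrite mem_iota add0n => /andP[_ ilt] e.
    by have := @pickle_invK J i; rewrite -e /= => ->.
  by exists (choice.pickle j); rewrite ?mem_iota// pickleK_inv.
(* The default is never taken, as [aE] shows. *)
pose a n := odflt pzero (osum x (pre n)).
have aE n : osum x (pre n) = Some (a n).
  by rewrite /a; have := H _ (pre_uniq n); case: osum.
have le_a n l : uniq l -> {subset l <= pre n} -> forall z, osum x l = Some z ->
    ea_le z (a n).
  move=> ul sub z lz; have := osum_sub x ul (pre_uniq n) sub.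
  by rewrite aE lz => /esym/padd_some_l [b _ zb]; exists b.
have [|s [sa sm]] := sea_sup (a := a).
  move=> n; apply: (@le_a n.+1 (pre n)) => // j; rewrite !pre_mem.
  exact: ltnW.
exists s; split=> [z [F]|b Hb].
  rewrite /sea_finsum pcm_seqsum_osum => Fz.
  have [n Fn] : exists n, {subset (F : seq J) <= pre n}.
    (* The successor is there because [pre n] holds the codes strictly below [n]. *)
    exists (\max_(j <- (F : seq J)) choice.pickle j).+1 => j jF.
    rewrite pre_mem ltnS.
    exact: (@leq_bigmax_seq J (F : seq J) xpredT (fun j => choice.pickle j)).
  have [d zd] := le_a n _ (fset_uniq F) Fn z Fz.
  have [d' ad'] := sa _ (ex_intro2 _ _ n I erefl).
  have : ole (Some z) s.
    by apply: (@ole_addl _ _ (Some d)); exists d'; rewrite /= zd.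
  by [].
apply: sm => _ [n _ <-]; apply: Hb.
exists [fset j in pre n]%fset.
rewrite /sea_finsum pcm_seqsum_osum -aE; apply: osum_perm.
apply: uniq_perm => // [|j]; last by rewrite inE.
exact: fset_uniq.
Qed.

Lemma sea_sum_sup J (x : J -> E) s : sea_sum E J x = Some s ->
  is_supremum (sea_finsums x) s.
Proof.
move=> xs.
have /sea_summableP/finsums_sup ex : isSome (sea_sum E J x) by rewrite xs.
move: xs; rewrite /sea_sum; case: asboolP => // _ [].
by case: pselect => // ex'; case: cid => t /= + <-.
Qed.

(** The offset [w] stands for the other terms of a larger sum, so that countable sums can be
    replaced by their finite subsums one at a time. *)
Lemma sea_sum_ole J (x : J -> E) s : sea_sum E J x = Some s ->
  forall w b, ole (oadd w (Some s)) b <->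
    forall l, uniq l -> ole (oadd w (osum x l)) b.
Proof.
move=> xs w b.
have /sea_summableP sx : isSome (sea_sum E J x) by rewrite xs.
(* The empty sum is the member that [ole_add_sup] asks for. *)
have f0 : sea_finsums x pzero by exists fset0; rewrite /sea_finsum.
rewrite (ole_add_sup (sea_sum_sup xs) f0).
rewrite -(sea_finsumsP x (fun u => ole (oadd w u) b)); split=> H.
  move=> F; case e : (sea_finsum x F) => [t|]; first by apply: H; exists F.
  by have := sx _ (fset_uniq F); rewrite -pcm_seqsum_osum [pcm_seqsum _]e.
by move=> a [F Fa]; rewrite -Fa.
Qed.

(** As [ole] includes definedness, the bound [ea_one] already gives summability; antisymmetry then
    determines the value. *)
Lemma sea_sumP J (x : J -> E) s : sea_sum E J x = Some s <->
  forall b, ole (Some s) b <-> forall l, uniq l -> ole (osum x l) b.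
Proof.
split=> [xs b|H].
  have := sea_sum_ole xs (Some pzero) b; rewrite oadd0 => ->.
  by split=> H l /H; rewrite oadd0.
have : isSome (sea_sum E J x).
  apply/sea_summableP => l ul; have /H/(_ _ ul) := ole_one s.
  exact: ole_isSome.
case xt : (sea_sum E J x) => [t|] // _; congr Some.
have ts b : ole (Some t) b <-> ole (Some s) b.
  rewrite H; have := sea_sum_ole xt (Some pzero) b; rewrite oadd0 => ->.
  by split=> H' l /H'; rewrite oadd0.
apply: ea_le_anti; first by apply/(ts s); apply: ea_le_refl.
by apply/(ts t); apply: ea_le_refl.
Qed.

(** By [osum_sub], the sum over the full enumeration is any given finite sum plus a rest, hence
    bounds it. *)
Lemma sea_sum_finite J (x : J -> E) (e : seq J) :
  uniq e -> (forall j, j \in e) -> sea_sum E J x = osum x e.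
Proof.
move=> ue eJ; have sub l ul := @osum_sub E J x l e ul ue (fun j _ => eJ j).
case es : (osum x e) => [s|]; last first.
  case xt : (sea_sum E J x) => [t|] //.
  have /sea_summableP/(_ _ ue) : isSome (sea_sum E J x) by rewrite xt.
  by rewrite es.
apply/sea_sumP => b; split=> [+ l ul|/(_ _ ue)]; last by rewrite es.
by rewrite -es (sub _ ul) => /ole_addl.
Qed.

Section Partition.
Variables (J K : countType) (p : J -> K) (x : J -> E) (y : K -> E).
Hypothesis fib : forall k, sea_sum E (fiber p k) (fun j => x (val j)) = Some (y k).

(** Induction on the list of blocks: the sum of block [k] is replaced by its finite subsums, and
    each of these in turn joins the offset for the remaining blocks. *)
Lemma ole_partition (G : seq K) w b : uniq G ->
  ole (oadd w (osum y G)) b <->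
  forall l, uniq l -> {in l, forall j, p j \in G} -> ole (oadd w (osum x l)) b.
Proof.
elim: G w => [|k G IH] w /=.
  rewrite osum_nil => _; split=> [H l _ lG|/(_ [::])]; last first.
    by rewrite osum_nil; apply.
  case: l lG => [|j l /(_ j)]; first by rewrite osum_nil.
  by rewrite inE eqxx => /(_ isT).
move=> /andP[kG uG].
rewrite osum_cons (oaddC (Some _)) oaddA (sea_sum_ole (fib k)); split.
- move=> H l ul lG.
  (* The members of [l] in block [k], retyped as the list [h] in the fiber, are separated from those
     left to the induction hypothesis. *)
  pose l1 := [seq j <- l | p j == k]; pose l2 := [seq j <- l | p j != k].
  pose h : seq (fiber p k) := pmap insub l1.
  have hE : map val h = l1.
    rewrite pmap_filter; last exact: insubK.
    apply/all_filterP/allP => j; rewrite mem_filter => /andP[pj _].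
    by rewrite isSome_insub.
  have uh : uniq h by apply: pmap_sub_uniq; apply: filter_uniq.
  have -> : osum x l = oadd (osum (fun j : fiber p k => x (val j)) h) (osum x l2).
    rewrite -[osum (fun j => x (val j)) h](osum_map val) hE -osum_cat.
    by apply: osum_perm; rewrite perm_sym perm_filterC.
  have := H _ uh; rewrite -oaddA (oaddC (osum y G)) !oaddA (IH _ uG).
  apply; first exact: filter_uniq.
  move=> j; rewrite mem_filter => /andP[pj /lG].
  by rewrite inE (negbTE pj).
- move=> H h uh; rewrite -oaddA (oaddC (osum y G)) oaddA IH// => l ul lG.
  rewrite -[osum _ h](osum_map (val : fiber p k -> J) x) -oaddA -osum_cat.
  apply: H.
    rewrite cat_uniq ul (map_inj_uniq val_inj) uh /= andbT.
    (* The lists are disjoint: [l] lies over [G], [h] over [k], and [k] is not in [G]. *)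
    apply/hasPn => j /lG pj; apply: contraNN kG => /mapP[i _ ji].
    by rewrite ji in pj; rewrite -(eqP (valP i)).
  move=> j; rewrite mem_cat inE => /orP[/mapP[i _ ->]|/lG ->]; rewrite ?orbT//.
  by rewrite (valP i).
Qed.

(** Both families have the same upper bounds for their finite sums, because a finite part of [J]
    meets only finitely many blocks. *)
Lemma sea_sum_fibers : sea_sum E J x = sea_sum E K y.
Proof.
apply: option_ext => s; rewrite !sea_sumP.
suff yx b : (forall G, uniq G -> ole (osum y G) b) <->
    (forall l, uniq l -> ole (osum x l) b).
  by split=> H b; rewrite H; [apply: iff_sym|]; apply: yx.
split=> H.
  (* The blocks to test are those that [l] meets. *)
  move=> l ul; have := H _ (undup_uniq (map p l)).
  rewrite -(oadd0 (osum y _)) ole_partition ?undup_uniq// => /(_ l ul).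
  rewrite oadd0; apply=> j jl; rewrite mem_undup; exact: map_f.
move=> G uG; rewrite -(oadd0 (osum y _)) ole_partition// => l ul _.
by rewrite oadd0; apply: H.
Qed.

End Partition.

Lemma sea_summable_inj J K (h : K -> J) (x : J -> E) : injective h ->
  isSome (sea_sum E J x) -> isSome (sea_sum E K (x \o h)).
Proof.
move=> hi /sea_summableP H; apply/sea_summableP => l ul.
by rewrite -osum_map; apply: H; rewrite map_inj_uniq.
Qed.

Lemma sea_partition J K (p : J -> K) (x : J -> E) (s : E) :
  sea_sum E J x = Some s <->
  exists y : K -> E,
    (forall k, sea_sum E (fiber p k) (fun j => x (val j)) = Some (y k)) /\
    sea_sum E K y = Some s.
Proof.
split=> [xs|[y [fib]]]; last by rewrite (sea_sum_fibers fib).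
have sf k : isSome (sea_sum E (fiber p k) (fun j => x (val j))).
  apply: (@sea_summable_inj J (fiber p k) val); first exact: val_inj.
  by rewrite xs.
pose y k := odflt pzero (sea_sum E (fiber p k) (fun j => x (val j))).
have fib k : sea_sum E (fiber p k) (fun j => x (val j)) = Some (y k).
  by rewrite /y; have := sf k; case: sea_sum.
by exists y; rewrite -(sea_sum_fibers fib).
Qed.

Lemma sea_unary J (j0 : J) (x : J -> E) :
  (forall j, j = j0) -> sea_sum E J x = Some (x j0).
Proof.
move=> Jj0; rewrite (@sea_sum_finite J x [:: j0])//.
  by rewrite osum_cons osum_nil oaddC oadd0.
by move=> j; rewrite inE (Jj0 j).
Qed.

Lemma sea_limit J (x : J -> E) :
  (forall F : {fset J}, isSome (sea_sum E F (fun j : F => x (val j)))) ->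
  isSome (sea_sum E J x).
Proof.
move=> H; apply/sea_summableP; apply/(sea_finsumsP x (fun u => isSome u)) => F.
have /sea_summableP/(_ _ (enum_uniq (fset_sub_type F))) := H F.
by rewrite -[osum _ (enum _)](osum_map val) -enum_fsetE /sea_finsum pcm_seqsum_osum.
Qed.

Definition sea_pam : sigma_pam E :=
  SigmaPAM (inhabits pzero) sea_partition sea_unary sea_limit.

Lemma sea_sum_pair (a b : E) : sea_sum E bool (pam_pair a b) = padd a b.
Proof.
rewrite (@sea_sum_finite _ _ [:: true; false])//; last by case.
by rewrite !osum_cons osum_nil /= (paddC b) padd0.
Qed.

Lemma sea_sum_void (x : void -> E) : sea_sum E void x = Some pzero.
Proof. by rewrite (@sea_sum_finite _ _ [::])// osum_nil. Qed.

End SigmaSum.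

(** * Special countable sums, and exchange of double sums *)

Lemma sea_sum_single (E : sigma_effect_algebra) (J : countType) (j : J) (a : E) :
  sea_sum E J (fun i => if i == j then a else pzero) = Some a.
Proof.
have sumE l : uniq l -> osum (fun i => if i == j then a else pzero) l =
    Some (if j \in l then a else pzero).
  elim: l => [|i l IH] /=; first by rewrite osum_nil.
  move=> /andP[il ul]; rewrite osum_cons IH// inE eq_sym.
  case: eqP il => [->|_] il; last exact: oadd0.
  by rewrite /= (negbTE il) paddC padd0.
apply/sea_sumP => b; split=> [ab l ul|/(_ [:: j] isT)].
  rewrite sumE//; case: ifP => // _.
  by exists b; apply: oadd0.
by rewrite sumE// inE eqxx.
Qed.

Lemma sigma_additive_padd (E F : sigma_effect_algebra) (f : E -> F) a b s :
  sigma_additive (sea_sum E) (sea_sum F) f ->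
  padd a b = Some s -> padd (f a) (f b) = Some (f s).
Proof.
rewrite -!sea_sum_pair => fadd /fadd <-.
by congr (sea_sum F bool _); apply/funext => -[].
Qed.

Lemma sigma_additive0 (E F : sigma_effect_algebra) (f : E -> F) :
  sigma_additive (sea_sum E) (sea_sum F) f -> f pzero = pzero.
Proof.
move=> /(_ _ _ _ (sea_sum_void (of_void _))).
by rewrite sea_sum_void => -[].
Qed.

(** Partition by the first projection, whose fiber over [j] is a copy of [K]. *)
Lemma sea_sum_double (E : sigma_effect_algebra) (J K : countType)
    (z : J -> K -> E) (y : J -> E) :
  (forall j, sea_sum E K (z j) = Some (y j)) ->
  sea_sum E (J * K)%type (fun u => z u.1 u.2) = sea_sum E J y.
Proof.
move=> zy; apply: (@sea_sum_fibers E _ _ (fun u : (J * K)%type => u.1)) => j.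
pose h (k : K) : fiber (fun u : (J * K)%type => u.1) j := exist _ (j, k) (eqxx j).
have bh : bijective h.
  exists (fun u => (val u).2) => // -[[j' k] /= e]; apply: val_inj => /=.
  by rewrite (eqP e).
by rewrite -zy; exact: esym (psum_reindex (sea_pam E) _ bh).
Qed.

(** Both sides are the sum over the product, up to swapping coordinates. This is what makes
    pointwise sums of additive maps additive. *)
Lemma sea_sum_exchange (E : sigma_effect_algebra) (J K : countType)
    (z : J -> K -> E) (a : J -> E) (b : K -> E) :
  (forall j, sea_sum E K (z j) = Some (a j)) ->
  (forall k, sea_sum E J (fun j => z j k) = Some (b k)) ->
  sea_sum E J a = sea_sum E K b.
Proof.
move=> /sea_sum_double <- /sea_sum_double <-.
pose sw (u : K * J) : J * K := (u.2, u.1).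
have bsw : bijective sw by exists (fun u => (u.2, u.1)) => -[].
by rewrite -[LHS](psum_reindex (sea_pam E) _ bsw).
Qed.

(** * Products of sigma-effect algebras *)

Section Collect.
Variables (T : Type) (X : T -> Type).

Definition collect (u : forall t, option (X t)) : option (forall t, X t) :=
  if pselect (exists h : forall t, X t, forall t, u t = Some (h t)) is left ex
  then Some (sval (cid ex)) else None.

Lemma collectP u h : collect u = Some h <-> forall t, u t = Some (h t).
Proof.
rewrite /collect; case: pselect => [ex|nex]; last first.
  by split=> // uh; case: nex; exists h.
case: cid => g /= ug; split=> [[<-]//|uh]; congr Some.
by apply: functional_extensionality_dep => t; move: (ug t); rewrite uh => -[].
Qed.

Lemma collect_exists u : (forall t, isSome (u t)) -> exists h, collect u = Some h.
Proof.
move=> us; suff [h uh] : exists h : forall t, X t, forall t, u t = Some (h t).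
  by exists h; apply/collectP.
have ex t : {h | u t = Some h} by case: (u t) (us t) => // h _; exists h.
by exists (fun t => sval (ex t)) => t; exact: svalP (ex t).
Qed.

Lemma eq_collect u v : (forall t, u t = v t) -> collect u = collect v.
Proof. by move=> uv; congr collect; apply: functional_extensionality_dep. Qed.

End Collect.

(** Composition of partial operations is componentwise, which reduces associativity in a product to
    its factors. *)
Lemma obind_collect (T : Type) (X Y : T -> Type)
    (F : forall t, X t -> option (Y t)) (u : forall t, option (X t)) :
  obind (fun h : forall t, X t => collect (fun t => F t (h t))) (collect u) =
  collect (fun t => obind (F t) (u t)).
Proof.
apply: option_ext => s; split.
  case e : (collect u) => [h|] //= /collectP Fs; move/collectP: e => uh.
  by apply/collectP => t; rewrite uh /= Fs.
move/collectP => Fs; have [|h e] := @collect_exists _ _ u.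
  by move=> t; have := Fs t; case: (u t).
rewrite e /=; apply/collectP => t; rewrite -Fs.
by move/collectP: e => ->.
Qed.

Section ProductPCM.
Variables (T : Type) (X : T -> pcm).

Definition prod_add (f g : forall t, X t) : option (forall t, X t) :=
  collect (fun t => padd (f t) (g t)).

Lemma prod_addA (f g h : forall t, X t) :
  obind (fun s => prod_add s h) (prod_add f g) =
  obind (prod_add f) (prod_add g h).
Proof.
rewrite /prod_add (obind_collect (fun t s => padd s (h t))).
rewrite (obind_collect (fun t => padd (f t))).
by apply: eq_collect => t; apply: paddA.
Qed.

Lemma prod_addC f g : prod_add f g = prod_add g f.
Proof. by apply: eq_collect => t; apply: paddC. Qed.

Lemma prod_add0 f : prod_add (fun t => pzero) f = Some f.
Proof. by apply/collectP => t; apply: padd0. Qed.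

Definition prod_pcm : pcm := PCM prod_addA prod_addC prod_add0.

Lemma osum_prod (J : Type) (F : J -> prod_pcm) l :
  osum F l = collect (fun t => osum (F ^~ t) l).
Proof.
elim: l => [|j l IH].
  by rewrite osum_nil; apply/esym/collectP => t; rewrite osum_nil.
rewrite osum_cons IH /oadd /= (obind_collect (fun t => padd (F j t))).
by apply: eq_collect => t; rewrite osum_cons.
Qed.

End ProductPCM.

Lemma prod_effect_axioms (T : Type) (E : T -> effect_algebra) :
  @is_effect_algebra (prod_pcm E) (fun t => ea_one).
Proof.
split=> [f|f].
  pose g t := sval (cid (compl_exists (f t))).
  have fg t : padd (f t) (g t) = Some ea_one by rewrite /g; case: cid.
  exists g; split=> [|h /collectP fh]; first exact/collectP.
  by apply: functional_extensionality_dep => t; apply: padd_cancel (fg t) (fh t).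
rewrite /orthogonal; case e : padd => [h|] // _; move/collectP: e => e.
apply: functional_extensionality_dep => t.
by have [_ H] := ea_axioms (E t); apply: H; rewrite /orthogonal e.
Qed.

Definition prod_ea (T : Type) (E : T -> effect_algebra) : effect_algebra :=
  EffectAlgebra (prod_effect_axioms E).

Lemma prod_leP (T : Type) (E : T -> effect_algebra) (f g : prod_ea E) :
  ea_le f g <-> forall t, ea_le (f t) (g t).
Proof.
split=> [[h /collectP fh] t|fg]; first by exists (h t).
by exists (fun t => sval (cid (fg t))); apply/collectP => t; case: cid.
Qed.

Lemma prod_sup (T : Type) (E : T -> sigma_effect_algebra) (a : nat -> prod_ea E) :
  (forall n, ea_le (a n) (a n.+1)) -> exists s, is_supremum (range a) s.
Proof.
move=> amon.
have ex t : exists s, is_supremum (range (fun n => a n t)) s.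
  by apply: sea_sup => n; have /prod_leP := amon n.
exists (fun t => sval (cid (ex t))); split=> [_ [n _ <-]|b ab].
  by apply/prod_leP => t; case: cid => s /= [sa _]; apply: sa; exists n.
apply/prod_leP => t; case: cid => s /= [_ sm]; apply: sm => _ [n _ <-].
by have /prod_leP : ea_le (a n) b by apply: ab; exists n.
Qed.

Definition prod_sea (T : Type) (E : T -> sigma_effect_algebra) :
    sigma_effect_algebra := SigmaEffectAlgebra (@prod_sup T E).

(** By [sea_sumP] a sum is determined by upper bounds of finite sums, and both order and finite sums
    are componentwise. *)
Lemma sea_sum_prod (T : Type) (E : T -> sigma_effect_algebra) (J : countType)
    (F : J -> prod_sea E) :
  sea_sum (prod_sea E) J F = collect (fun t => sea_sum (E t) J (F ^~ t)).
Proof.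
case e : (collect _) => [s|].
  move/collectP: e => Fs; apply/sea_sumP => b; split.
    move=> /prod_leP sb l ul.
    have le t : ole (osum (F ^~ t) l) (b t).
      by have /sea_sumP := Fs t; move=> /(_ (b t))[/(_ (sb t) l ul)].
    have [|h lh] := @collect_exists _ _ (fun t => osum (F ^~ t) l).
      by move=> t; apply: ole_isSome (le t).
    rewrite (osum_prod F) lh; apply/prod_leP => t.
    by have := le t; move/collectP: lh => ->.
  move=> H; apply/prod_leP => t.
  have /sea_sumP/(_ (b t))[_] := Fs t; apply=> l ul.
  have := H l ul; rewrite (osum_prod F); case lh : collect => [h|]; last by case.
  by move/collectP: lh => -> /(@prod_leP T E h b) hb; apply: hb.
(* A sum defined in the product would make every component summable, against [e]. *)
case Fs : (sea_sum (prod_sea E) J F) => [s|] //.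
have [|h] := @collect_exists _ _ (fun t => sea_sum (E t) J (F ^~ t)).
  move=> t; apply/sea_summableP => l ul.
  have /sea_summableP/(_ l ul) : isSome (sea_sum (prod_sea E) J F) by rewrite Fs.
  by rewrite (osum_prod F); case lh : collect => [h|] // _; move/collectP: lh => ->.
by rewrite e.
Qed.

(** * Products of modules *)

Section Modules.
Variable M : sigma_effect_monoid.
Implicit Types E F G : sigma_effect_module M.

Section Product.
Variables (T : Type) (E : T -> sigma_effect_module M).

Definition prod_act (r : M) (f : prod_sea E) : prod_sea E :=
  fun t => smod_act r (f t).

Lemma prod_act_biadditive :
  sigma_biadditive (sea_sum M) (sea_sum (prod_sea E)) (sea_sum (prod_sea E))
    prod_act.
Proof.
split=> [r J f s|f J r s rs].
  rewrite !sea_sum_prod => /collectP fs; apply/collectP => t.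
  by have [/(_ r) H _] := smod_act_biadditive (E t); apply: H (fs t).
rewrite sea_sum_prod; apply/collectP => t.
by have [_ /(_ (f t)) H] := smod_act_biadditive (E t); apply: H rs.
Qed.

Lemma prod_act1 f : prod_act ea_one f = f.
Proof. by apply: functional_extensionality_dep => t; apply: smod_act1. Qed.

Lemma prod_actA r s f : prod_act (sem_mul r s) f = prod_act r (prod_act s f).
Proof. by apply: functional_extensionality_dep => t; apply: smod_actA. Qed.

Definition prod_module : sigma_effect_module M :=
  SigmaEffectModule prod_act_biadditive prod_act1 prod_actA.

Lemma prod_proj_additive t :
  sigma_additive (sea_sum prod_module) (sea_sum (E t)) (fun f : prod_module => f t).
Proof. by move=> J f s; rewrite sea_sum_prod => /collectP. Qed.

Definition prod_proj t : smod_hom prod_module (E t) :=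
  @SmodHom M prod_module (E t) (fun f => f t) (@prod_proj_additive t)
    (fun r f => erefl).

Section Tuple.
Variables (G : sigma_effect_module M) (g : forall t, smod_hom G (E t)).

Lemma prod_tuple_additive :
  sigma_additive (sea_sum G) (sea_sum prod_module)
    (fun x => (fun t => g t x) : prod_module).
Proof.
move=> J x s xs; rewrite sea_sum_prod; apply/collectP => t.
exact: smod_map_additive xs.
Qed.

Lemma prod_tuple_linear r x :
  (fun t => g t (smod_act r x)) = smod_act r ((fun t => g t x) : prod_module).
Proof. by apply: functional_extensionality_dep => t; apply: smod_map_linear. Qed.

Definition prod_tuple : smod_hom G prod_module :=
  SmodHom prod_tuple_additive prod_tuple_linear.

End Tuple.
End Product.

(** * Pointwise sums of module maps *)

Section HomSum.
Variables E F : sigma_effect_module M.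

(** A homomorphism is demanded as witness so that the sum stays in the homset; by [hom_sum_exists],
    pointwise summability suffices. *)
Definition hom_sum : countable_sum (smod_hom E F) := fun J f =>
  if pselect (exists s : smod_hom E F,
                forall x, sea_sum F J (fun j => f j x) = Some (s x)) is left ex
  then Some (sval (cid ex)) else None.

Lemma hom_sumP (J : countType) (f : J -> smod_hom E F) s :
  hom_sum f = Some s <-> forall x, sea_sum F J (fun j => f j x) = Some (s x).
Proof.
rewrite /hom_sum; case: pselect => [ex|nex]; last first.
  by split=> // fs; case: nex; exists s.
case: cid => g /= fg; split=> [[<-]//|fs]; congr Some.
by apply: smod_hom_ext => x; move: (fg x); rewrite fs => -[].
Qed.

(** The pointwise sum is additive by exchanging two countable sums, and linear because each scalar
    acts additively on [F]. *)
Lemma hom_sum_exists (J : countType) (f : J -> smod_hom E F) :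
  (forall x, isSome (sea_sum F J (fun j => f j x))) ->
  exists s, hom_sum f = Some s.
Proof.
move=> fsome; pose s x := odflt pzero (sea_sum F J (fun j => f j x)).
have fs x : sea_sum F J (fun j => f j x) = Some (s x).
  by rewrite /s; have := fsome x; case: sea_sum.
have sadd : sigma_additive (sea_sum E) (sea_sum F) s.
  move=> K x t xt; rewrite -fs; apply/esym.
  apply: (sea_sum_exchange (z := fun j k => f j (x k))) => [j|k].
    exact: smod_map_additive xt.
  exact: fs.
have slin r x : s (smod_act r x) = smod_act r (s x).
  have [/(_ r _ _ _ (fs x)) + _] := smod_act_biadditive F.
  have := fs (smod_act r x).
  rewrite (_ : (fun j => f j (smod_act r x)) = smod_act r \o (fun j => f j x)).
    by move=> -> [].
  by apply/funext => j; apply: smod_map_linear.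
by exists (SmodHom sadd slin); apply/hom_sumP.
Qed.

(** The empty family provides the zero map. *)
Lemma hom_inhabited : inhabited (smod_hom E F).
Proof.
have [|s _] := @hom_sum_exists void (of_void _); last exact: (inhabits s).
by move=> x; rewrite sea_sum_void.
Qed.

Lemma hom_partition (J K : countType) (p : J -> K) (f : J -> smod_hom E F) s :
  hom_sum f = Some s <->
  exists y : K -> smod_hom E F,
    (forall k, hom_sum (fun j : fiber p k => f (val j)) = Some (y k)) /\
    hom_sum y = Some s.
Proof.
split=> [/hom_sumP fs|[y [fib /hom_sumP ys]]]; last first.
  apply/hom_sumP => x; rewrite -ys; apply: sea_sum_fibers => k.
  by have /hom_sumP := fib k.
have ex k : exists y, hom_sum (fun j : fiber p k => f (val j)) = Some y.
  apply: hom_sum_exists => x.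
  by have /(sea_partition p)[y [-> _]] := fs x.
exists (fun k => sval (cid (ex k))).
have fib k := svalP (cid (ex k)); split=> //.
apply/hom_sumP => x; rewrite -fs; apply/esym/sea_sum_fibers => k.
by have /hom_sumP := fib k.
Qed.

Lemma hom_unary (J : countType) (j0 : J) (f : J -> smod_hom E F) :
  (forall j, j = j0) -> hom_sum f = Some (f j0).
Proof. by move=> Jj0; apply/hom_sumP => x; rewrite (sea_unary _ Jj0). Qed.

Lemma hom_limit (J : countType) (f : J -> smod_hom E F) :
  (forall A : {fset J}, isSome (hom_sum (fun j : A => f (val j)))) ->
  isSome (hom_sum f).
Proof.
move=> H; have [x|s -> //] := @hom_sum_exists _ f; apply: sea_limit => A.
by have := H A; case e : hom_sum => [s|] // _; move/hom_sumP: e => ->.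
Qed.

Definition hom_pam : sigma_pam (smod_hom E F) :=
  SigmaPAM hom_inhabited hom_partition hom_unary hom_limit.

Lemma hom_zeroE x : pam_zero hom_pam x = pzero.
Proof.
have /hom_sumP/(_ x) := svalP (psum_void hom_pam) (of_void _).
by rewrite sea_sum_void => -[].
Qed.

Lemma hom_addP f g s :
  pam_add hom_pam f g = Some s <-> forall x, padd (f x) (g x) = Some (s x).
Proof.
have e x : sea_sum F bool (fun b => pam_pair f g b x) = padd (f x) (g x).
  rewrite -sea_sum_pair; congr (sea_sum F bool _).
  by apply/funext => -[].
by split=> [/hom_sumP H x|H]; [rewrite -e|apply/hom_sumP => x; rewrite e].
Qed.

Lemma hom_orthogonalP f g :
  orthogonal (X := pam_pcm hom_pam) f g <-> forall x, orthogonal (f x) (g x).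
Proof.
rewrite /orthogonal -[padd f g]/(pam_add hom_pam f g); split=> [|H].
  case e : (pam_add hom_pam f g) => [s|] // _ x.
  by rewrite (proj1 (hom_addP f g s) e).
have [x|s] := @hom_sum_exists _ (pam_pair f g).
  have := H x; rewrite -sea_sum_pair.
  by rewrite (_ : (fun b => _) = pam_pair (f x) (g x))//; apply/funext => -[].
by rewrite -[hom_sum _]/(pam_add hom_pam f g) => ->.
Qed.

End HomSum.

(** * Control of a map by its value at the unit *)

Lemma orthogonal_le (E : effect_algebra) (a b a' b' : E) :
  ea_le a a' -> ea_le b b' -> orthogonal a' b' -> orthogonal a b.
Proof.
move=> [c ac] [d bd]; rewrite /orthogonal.
have -> : padd a' b' = oadd (oadd (Some a) (Some b)) (oadd (Some c) (Some d)).
  rewrite -oaddA (oaddA (Some b)) (oaddC (Some b)) -(oaddA (Some c)) oaddA /=.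
  by rewrite ac bd.
by rewrite /=; case: (padd a b).
Qed.

(** The difference is the image of the complement of [x]. *)
Lemma smod_map_le1 E F (f : smod_hom E F) x : ea_le (f x) (f ea_one).
Proof.
have [y xy] := compl_exists x; exists (f y).
exact: sigma_additive_padd (smod_map_additive f) xy.
Qed.

Lemma smod_map_orthogonal1 E E' F (f : smod_hom E F) (g : smod_hom E' F) x y :
  orthogonal (f ea_one) (g ea_one) -> orthogonal (f x) (g y).
Proof. by apply: orthogonal_le; apply: smod_map_le1. Qed.

Section Scalar.
Variables (E : sigma_effect_module M) (e : E).

Lemma scalar_additive :
  sigma_additive (sea_sum (regular_module M)) (sea_sum E) (smod_act ^~ e).
Proof. by have [_ /(_ e)] := smod_act_biadditive E. Qed.

(** By [regular_homE] every map out of [M] has this form; taking [e] to be the unit of [E] gives the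
    top map. *)
Definition scalar_hom : smod_hom (regular_module M) E :=
  @SmodHom M (regular_module M) E (smod_act ^~ e) scalar_additive
    (fun r s => smod_actA r s e).

End Scalar.

Lemma smod_act_additive E (r : M) :
  sigma_additive (sea_sum E) (sea_sum E) (smod_act r).
Proof. by have [/(_ r)] := smod_act_biadditive E. Qed.

Lemma regular_homE E (f : smod_hom (regular_module M) E) r :
  f r = smod_act r (f ea_one).
Proof. by rewrite -smod_map_linear /= sem_mul1. Qed.

(** * The sigma-PAC structure on the dual category *)

Let C := opposite (sigmaEMod M).

(** Left transparent because later proofs compute with its projections and tuples. *)
Definition op_coproduct (J : countType) (B : J -> C) : coproduct B.
Proof.
refine (@Coproduct C J B (@prod_module J B) (@prod_proj J B)
  (@prod_tuple J B) _ _).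
  by move=> X f j; apply: smod_hom_ext.
move=> X f h hf; apply: smod_hom_ext => x.
by apply: functional_extensionality_dep => j; rewrite /= -hf.
Defined.

Definition op_hom_pam (A B : C) : sigma_pam (hom A B) := hom_pam B A.

Lemma op_comp_biadditive (A B D : C) :
  sigma_biadditive (psum (op_hom_pam B D)) (psum (op_hom_pam A B))
    (psum (op_hom_pam A D)) compm.
Proof.
split=> [g J f s /hom_sumP fs|f J g s /hom_sumP gs]; apply/hom_sumP => x /=.
  exact: fs.
exact: smod_map_additive (gs x).
Qed.

(** Read as a module map, [g] goes from the power of [B] to [A]. The constant family at [x] is the
    sum of the insertions of [x], and [g] carries these to the [f j x]. *)
Lemma op_compatible_sum (A B : C) (J : countType) (f : J -> hom A B) :
  compatible op_hom_pam (op_coproduct (fun _ : J => B)) f ->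
  isSome (psum (op_hom_pam A B) f).
Proof.
move=> [g gf]; have [x|s] := @hom_sum_exists _ _ _ f; last by move=> /= ->.
pose S := op_coproduct (fun _ : J => B).
pose d j : prod_module (fun _ : J => B) := partial_projection op_hom_pam S j x.
(* In the dual, a partial projection is the insertion of [B] as one factor: the identity on that
   component, zero on the others. *)
have dE i j : d i j = if i == j then x else pzero.
  rewrite /d; case: eqP => [<-|/eqP ij].
    have := partial_projection_eq op_hom_pam S i.
    by move=> /(congr1 (fun h : smod_hom B B => h x)).
  have := @partial_projection_neq _ op_hom_pam _ _ S i j.
  rewrite eq_sym => /(_ ij) /(congr1 (fun h : smod_hom B B => h x)) /= ->.
  exact: hom_zeroE.
(* Each component of this sum has a single possibly nonzero term, equal to [x]. *)
have dx : sea_sum (prod_module (fun _ : J => B)) J d = Some (fun=> x).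
  rewrite sea_sum_prod; apply/collectP => j.
  by rewrite -(sea_sum_single j x); congr sea_sum; apply/funext => i.
have := smod_map_additive g dx.
rewrite (_ : g \o d = fun j => f j x); first by move=> ->.
by apply/funext => j; rewrite -gf.
Qed.

(** At a pair [x] the composites take the values [f (x true)] and [g (x false)], bounded by the
    values of [f] and [g] at the unit. *)
Lemma op_untying (A B : C) (f g : hom A B) :
  let BB := op_coproduct (fun _ : bool => B) in
  orthogonal (X := pam_pcm (op_hom_pam A B)) f g ->
  orthogonal (X := pam_pcm (op_hom_pam A BB))
    (compm (coproj BB true) f) (compm (coproj BB false) g).
Proof.
move=> /= /hom_orthogonalP fg; apply/hom_orthogonalP => x /=.
exact: smod_map_orthogonal1 (fg ea_one).
Qed.

Definition op_pac : sigma_pac_structure C :=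
  SigmaPACStructure op_comp_biadditive op_compatible_sum op_untying.

(** Evaluation at the unit identifies maps from [M] to [E] with elements of [E], so complements are
    taken in [E]. *)
Lemma regular_hom_effect_algebra E :
  @is_effect_algebra (pam_pcm (hom_pam (regular_module M) E))
    (scalar_hom (ea_one : E)).
Proof.
split=> [f|f /hom_orthogonalP/(_ ea_one) /=]; last first.
  rewrite smod_act1 => /(proj2 (ea_axioms E)) f1.
  apply: smod_hom_ext => r; rewrite hom_zeroE regular_homE f1.
  exact: sigma_additive0 (@smod_act_additive E r).
have [e fe] := compl_exists (f ea_one).
exists (scalar_hom e); split=> [|g /hom_addP/(_ ea_one) fg].
  apply/hom_addP => r; rewrite regular_homE /=.
  by rewrite (sigma_additive_padd (@smod_act_additive E r) fe).
apply: smod_hom_ext => r; rewrite [RHS]regular_homE /=; congr smod_act.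
by apply: padd_cancel fe _; rewrite fg /= smod_act1.
Qed.

End Modules.

Theorem proposition63 (M : sigma_effect_monoid) :
  is_sigma_effectus (C := opposite (sigmaEMod M)) (regular_module M).
Proof.
exists (op_pac M), (fun A => scalar_hom (ea_one : (A : sigma_effect_module M))).
split=> [A|A B f f1|A B f g /hom_orthogonalP/(_ ea_one) fg].
- exact: regular_hom_effect_algebra.
(* Evaluating the composite with the top map at the unit gives [f ea_one], which is thus zero and
   bounds every [f x]. *)
- apply: smod_hom_ext => x; rewrite hom_zeroE.
  move: f1 => /(congr1 (fun h : smod_hom (regular_module M) A => h ea_one)).
  rewrite hom_zeroE /= smod_act1 => f1.
  by have [y] := smod_map_le1 f x; rewrite f1 => /padd_eq0.
(* Likewise, orthogonality of the composites at the unit is that of [f ea_one] and [g ea_one]. *)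
- apply/hom_orthogonalP => x; apply: smod_map_orthogonal1.
  by move: fg; rewrite /= !smod_act1.
Qed.
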